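(* For the prevalent $f\in C[0,1]$, for the generic $y\in f([0,1])$ the level set $f^{-1}(y)$ is perfect. That is, the set of all $f\in C[0,1]$ such that $\{y\in f([0,1]): f^{-1}(y)\text{ is perfect}\}$ is co-meager in $f([0,1])$ is a prevalent subset of $C[0,1]$.
   Context: $C[0,1]$ is the Banach space of continuous functions $f\colon[0,1]\to\mathbb{R}$ with the supremum metric, regarded as an abelian Polish group under addition. A set $A\subset C[0,1]$ is shy (or Haar null) if there exist a Borel set $B\subset C[0,1]$ and a Borel probability measure $\mu$ on $C[0,1]$ such that $A\subset B$ and $\mu(B+f)=0$ for all $f\in C[0,1]$. A set is prevalent if its complement is shy. ''For the prevalent $f$, $\mathcal{P}(f)$ holds'' means that the set of $f$ satisfying $\mathcal{P}$ is prevalent. ''Generic'' is in the sense of Baire category: a property holds for the generic element of a complete metric space $X$ if the set of elements having it is co-meager in $X$. Here $X=f([0,1])$ with the metric inherited from $\mathbb{R}$. A set is perfect if it is closed and has no isolated points. *)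

(* Defs.v *)
From HB Require Import structures.
From mathcomp Require Import all_boot all_order all_algebra.
From mathcomp Require Import all_classical all_reals all_analysis.
From mathcomp Require Import ring.

Set Implicit Arguments.
Unset Strict Implicit.
Unset Printing Implicit Defensive.

Import Order.TTheory GRing.Theory Num.Theory.
Import numFieldNormedType.Exports.

Local Open Scope classical_set_scope.
Local Open Scope ring_scope.

Definition unit_itv (R : realType) : set R := `[0, 1].
Arguments unit_itv R : clear implicits.

(* [continuousType] carries no canonical topology in the library, hence the
   alias, which is equipped below with the pointwise vector space structure
   and the sup norm. *)
Definition C01 (R : realType) : Type :=
  continuousType (set_type (unit_itv R)) R.

Section C01_normedModType.
Context {R : realType}.
Local Notation I := (set_type (unit_itv R)).
Implicit Types (f g h : C01 R) (t : I).

Lemma C01_continuous f : continuous f.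
Proof. exact: cts_fun. Qed.

Definition C01_of (u : I -> R) (cu : continuous u) : C01 R := mkcts cu.

Lemma C01P f g : f =1 g -> f = g.
Proof. by move=> fg; apply/continuousEP. Qed.

HB.instance Definition _ := gen_eqMixin (C01 R).
HB.instance Definition _ := gen_choiceMixin (C01 R).

Lemma C01_zero_subproof : continuous (fun _ : I => 0 : R).
Proof. exact: cst_continuous. Qed.

Lemma C01_opp_subproof f : continuous (fun t => - f t).
Proof. by move=> x; exact: cvgN (@C01_continuous f x). Qed.

Lemma C01_add_subproof f g : continuous (fun t => f t + g t).
Proof. by move=> x; exact: cvgD (@C01_continuous f x) (@C01_continuous g x). Qed.

Lemma C01_scale_subproof (a : R) f : continuous (fun t => a * f t).
Proof. by move=> x; exact: cvgMr (@C01_continuous f x). Qed.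

Definition C01_zero := C01_of C01_zero_subproof.
Definition C01_opp f := C01_of (@C01_opp_subproof f).
Definition C01_add f g := C01_of (@C01_add_subproof f g).
Definition C01_scale a f := C01_of (@C01_scale_subproof a f).

Lemma C01_addA : associative C01_add.
Proof. by move=> f g h; apply: C01P => t; exact: addrA. Qed.

Lemma C01_addC : commutative C01_add.
Proof. by move=> f g; apply: C01P => t; exact: addrC. Qed.

Lemma C01_add0 : left_id C01_zero C01_add.
Proof. by move=> f; apply: C01P => t; exact: add0r. Qed.

Lemma C01_addN : left_inverse C01_zero C01_opp C01_add.
Proof. by move=> f; apply: C01P => t; exact: addNr. Qed.

HB.instance Definition _ :=
  GRing.isZmodule.Build (C01 R) C01_addA C01_addC C01_add0 C01_addN.

Lemma C01_scaleA a b f : C01_scale a (C01_scale b f) = C01_scale (a * b) f.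
Proof. by apply: C01P => t; exact: mulrA. Qed.

Lemma C01_scale1 : left_id 1 C01_scale.
Proof. by move=> f; apply: C01P => t; exact: mul1r. Qed.

Lemma C01_scaleDr : right_distributive C01_scale +%R.
Proof. by move=> a f g; apply: C01P => t; exact: mulrDr. Qed.

Lemma C01_scaleDl f : {morph C01_scale^~ f : a b / a + b}.
Proof. by move=> a b; apply: C01P => t; exact: mulrDl. Qed.

HB.instance Definition _ := GRing.Zmodule_isLmodule.Build R (C01 R)
  C01_scaleA C01_scale1 C01_scaleDr C01_scaleDl.

Definition C01_norm f : R := sup (range (fun t => `|f t|)).

Lemma C01_norm_has_sup f : has_sup (range (fun t => `|f t|)).
Proof.
have I0 : unit_itv R 0 by rewrite /unit_itv /= in_itv /= lexx ler01.
split; first by exists `|f (exist _ 0 (mem_set I0))|; exists (exist _ 0 (mem_set I0)).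
have /subspace_valL_continuousP cf := @C01_continuous f.
have := continuous_compact cf (@segment_compact _ 0 1).
move=> /compact_bounded [M [_ /(_ (M + 1))]].
rewrite ltrDl ltr01 => /(_ isT) fM.
exists (M + 1) => _ [t _ <-]; apply: fM; exists (val t); first exact: set_valP.
by rewrite -[in RHS](@valLK _ _ point _ f).
Qed.

Lemma C01_norm_ub f t : `|f t| <= C01_norm f.
Proof. by apply: (sup_upper_bound (C01_norm_has_sup f)); exists t. Qed.

Lemma C01_norm_le f (M : R) : (forall t, `|f t| <= M) -> C01_norm f <= M.
Proof.
move=> fM; apply: ge_sup; first by case: (C01_norm_has_sup f).
by move=> _ [t _ <-].
Qed.

Lemma C01_ler_normD f g : C01_norm (f + g) <= C01_norm f + C01_norm g.
Proof.
apply: C01_norm_le => t; apply: le_trans (ler_normD _ _) _.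
by apply: lerD; exact: C01_norm_ub.
Qed.

Lemma C01_normrZ (a : R) f : C01_norm (a *: f) = `|a| * C01_norm f.
Proof.
have leZ b h : C01_norm (b *: h) <= `|b| * C01_norm h.
  apply: C01_norm_le => t; rewrite normrM.
  by apply: ler_wpM2l => //; exact: C01_norm_ub.
apply/eqP; rewrite eq_le leZ /=.
have [->|a0] := eqVneq a 0.
  rewrite normr0 mul0r; have [[_ [t _ _]] _] := C01_norm_has_sup f.
  exact: le_trans (C01_norm_ub _ t).
rewrite -ler_pdivlMl ?normr_gt0// -normfV.
by rewrite -{1}[f](@scale1r R (C01 R)) -(mulVf a0) -scalerA; exact: leZ.
Qed.

Lemma C01_normr0_eq0 f : C01_norm f = 0 -> f = 0.
Proof.
move=> f0; apply: C01P => t; apply/eqP.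
by rewrite -normr_le0 -f0; exact: C01_norm_ub.
Qed.

HB.instance Definition _ := Lmodule_isNormed.Build R (C01 R)
  C01_ler_normD C01_normrZ C01_normr0_eq0.

Lemma C01_complete (F : set_system (C01 R)) :
  ProperFilter F -> cauchy F -> cvg F.
Proof.
move=> FF /cauchy_ballP Fc.
have Fct (t : I) : cvg ((fun f => f t) @ F).
  apply/cauchy_cvgP/cauchy_ballP => e e0; near_simpl.
  apply: filterS (Fc e e0) => -[f g] /=; rewrite -!ball_normE /=.
  by apply: le_lt_trans; exact: (C01_norm_ub (f - g) t).
pose u (t : I) : R := lim ((fun f => f t) @ F).
have Fu (e : R) : 0 < e -> F [set f : C01 R | forall t, `|u t - f t| <= e].
  move=> e0; near=> f => t; apply/ler_addgt0Pr => d d0; near F => g.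
  have fg : `|f - g| < e.
    suff : ball f e g by rewrite -ball_normE.
    by near: g; near: f; apply: nearP_dep; exact: Fc.
  have ug : `|u t - g t| < d.
    by near: g; by have /cvgrPdist_lt/(_ _ d0) := Fct t.
  rewrite [e + d]addrC; apply: le_trans (ler_distD (g t) _ _) _.
  apply: lerD; first exact: ltW.
  by rewrite distrC; apply: le_trans (C01_norm_ub (f - g) t) (ltW fg).
have cu : continuous u.
  move=> x; apply/(@cvgrPdist_le _ _ _ _ (nbhs_filter x)) => e e0.
  have e3 : 0 < e / 3%:R by rewrite divr_gt0// ltr0n.
  near F => f; have uf : forall t, `|u t - f t| <= e / 3%:R.
    by near: f; exact: Fu.
  have /cvgrPdist_le/(_ _ e3) := @C01_continuous f x.
  apply: filterS => y fxy.
  have -> : e = e / 3%:R + e / 3%:R + e / 3%:R by field.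
  apply: le_trans (ler_distD (f y) _ _) _.
  apply: lerD; last by rewrite distrC.
  by apply: le_trans (ler_distD (f x) _ _) _; apply: lerD.
apply/cvg_ex; exists (C01_of cu); apply/cvgrPdist_le => e e0.
by apply: filterS (Fu e e0) => f fe; exact: C01_norm_le.
Unshelve. all: by end_near. Qed.

HB.instance Definition _ :=
  Uniform_isComplete.Build (C01 R) C01_complete.

End C01_normedModType.

Definition borelType {R : realType} (V : normedModType R) :=
  g_sigma_algebraType (@open V).

Definition shy {R : realType} {V : normedModType R} (A : set V) : Prop :=
  exists (B : set V) (mu : probability (borelType V) R),
    [/\ measurable (B : set (borelType V)), A `<=` B &
        forall f : V, mu [set x + f | x in B] = 0%E].

Definition prevalent {R : realType} {V : normedModType R} (A : set V) : Prop :=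
  shy (~` A).

Definition nowhere_dense {T : topologicalType} (A : set T) : Prop :=
  (closure A)^° = set0.

Definition meager {T : topologicalType} (A : set T) : Prop :=
  exists2 F : (set T)^nat, (forall n, nowhere_dense (F n)) & A = \bigcup_n F n.

Definition comeager {T : topologicalType} (A : set T) : Prop := meager (~` A).

(* Main.v *)
Require Import Defs.
From mathcomp Require Import all_boot all_order all_algebra.
From mathcomp Require Import all_classical all_reals all_analysis.
From mathcomp Require Import measurable_realfun ring lra.

Set Implicit Arguments.
Unset Strict Implicit.
Unset Printing Implicit Defensive.

Import Order.TTheory GRing.Theory Num.Theory.
Import numFieldNormedType.Exports.
Local Open Scope classical_set_scope.
Local Open Scope ring_scope.

(** The argument splits into a deterministic and a probabilistic half, which
    meet in the notion of a function that is monotone on no interval.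

    Deterministic half: if [f] is nowhere monotone, then the generic level set
    is perfect ([comeager_perfect_level]).  An isolated point of the closed set
    [f^-1(y)] is the only preimage of [y] in some interval with rational
    endpoints [a < b], so the bad values are covered by countably many sets
    [sole_level f a b].  Each of these is nowhere dense.  Otherwise it is dense
    in some interval of values; take two of its values [f t1 < f t2] there, with
    sole preimages [t1] and [t2].  By the intermediate value theorem [f] cannot
    leave [[f t1, f t2]] between [t1] and [t2] without taking one of these
    values again, and it cannot turn back either, since it would then take twice
    all values of an interval, one of which has a sole preimage.  So [f] is
    monotone between [t1] and [t2], a contradiction
    ([nondecreasing_between_sole]).

    Probabilistic half: the nowhere monotone functions are prevalent.  The
    measure is the law of [t *: rough], with [t] uniform on [[0, 1]] and
    [rough x = \sum_k 2^-k cos(8^k pi x)], a Weierstrass function of infinite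
    variation on every interval.  If [s *: rough + f] and [t *: rough + f] were
    both monotone on the same interval with [s != t], their difference
    [(s - t) *: rough] would have bounded variation there; hence each interval
    accounts for at most one [t] ([cell_monotone_line]).  Countably many
    intervals, the cells of the grids of step [8^-N], suffice, so for every [f]
    only countably many [t] are exceptional, and these form a null set
    ([shy_of_countable_line]). *)

(** * Evaluation and intermediate values in C[0,1] *)

Section ContinuousFunctions.
Context {R : realType}.
Local Notation I := (set_type (unit_itv R)).
Implicit Types (f g : C01 R) (s t r : I) (a b x y : R).

Lemma unit_itvP t : 0 <= val t <= 1.
Proof. by have := set_valP t; rewrite /unit_itv /= in_itv. Qed.

Lemma C01_eval_continuous t : continuous (fun f : C01 R => f t).
Proof.
move=> f; apply/(@cvgrPdist_lt _ _ _ _ (nbhs_filter f)) => e e0.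
have : \forall h \near f, `|f - h| < e.
  by apply/nbhs_ballP; exists e => // h; rewrite -ball_normE.
apply: (@filterS _ (nbhs f) (nbhs_filter f)) => h; apply: le_lt_trans.
exact: (C01_norm_ub (f - h) t).
Qed.

Lemma C01_IVT f s t y : val s <= val t ->
  Num.min (f s) (f t) <= y <= Num.max (f s) (f t) ->
  exists2 r, val s <= val r <= val t & f r = y.
Proof.
move=> st fy; have /subspace_valL_continuousP cf := @C01_continuous R f.
have valLf r : valL f (val r) = f r.
  by rewrite -[in RHS](@valLK _ _ point _ f).
have /andP[s0 s1] := unit_itvP s; have /andP[t0 t1] := unit_itvP t.
have [|||c] := @IVT R (valL f) (val s) (val t) y => //.
- apply: continuous_subspaceW cf => x.
  rewrite /unit_itv /= !in_itv /= => /andP[sx xt].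
  by rewrite (le_trans s0 sx) (le_trans xt t1).
- by rewrite !valLf.
rewrite in_itv /= => /andP[sc ct] fc.
have c01 : unit_itv R c.
  by rewrite /unit_itv /= in_itv /= (le_trans s0 sc) (le_trans ct t1).
exists (SigSub (mem_set c01)); first by rewrite /= sc.
by rewrite -valLf.
Qed.

(** Total in [x], so that grid points of the unit interval can be written
    without carrying a membership proof. *)
Definition clamp x : I.
Proof.
refine (SigSub (x := Num.max 0 (Num.min x 1)) (mem_set _)).
by rewrite /unit_itv /= in_itv /= le_max lexx ge_max ler01 ge_min lexx orbT.
Defined.

Lemma val_clamp x : 0 <= x <= 1 -> val (clamp x) = x.
Proof. by move=> /andP[x0 x1] /=; rewrite min_l// max_r. Qed.

End ContinuousFunctions.

(** * A one-dimensional criterion for shyness *)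

(** For [t] uniform on [[0, 1]], the law of [t *: g] gives mass zero to any set
    met by only countably many [t].  A translate of [B] meets the line through
    [0] of direction [g] as [B] itself meets a parallel line. *)
Lemma shy_of_countable_line (R : realType) (V : normedModType R) (g : V)
    (A B : set V) :
  measurable (B : set (borelType V)) -> A `<=` B ->
  (forall f : V, countable [set t : R | B (t *: g + f)]) -> shy A.
Proof.
move=> mB AB Bg.
pose line (t : measurableTypeR R) : borelType V := t *: g.
have mline : measurable_fun [set: measurableTypeR R] line.
  apply: (@measurability _ _ _ (borelType V) setT line (@open V) erefl).
  move=> _ [U oU <-]; rewrite setTI; apply: open_measurable.
  have lineC : continuous (fun t : R => t *: g) by exact: scalel_continuous.
  exact: (iffLR (continuousP _) lineC).
pose X : {mfun _ >-> _} := mfun_Sub (mem_set mline).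
exists B, (distribution (uniform_prob (@ltr01 R)) X); split => // f.
rewrite /distribution /pushforward /=.
have -> : X @^-1` [set x + f | x in B] = [set t | B (t *: g - f)].
  apply/seteqP; split => t /=.
    by move=> [h Bh hE]; have <- : h + f = t *: g by []; rewrite addrK.
  by move=> Bt; exists (t *: g - f) => //; exact: subrK.
have Bf := Bg (- f).
pose D := dominates_uniform_prob (@ltr01 R).
apply: (iffLR (null_content_dominatesP _ _) D).
  by apply: countable_measurable Bf => x; exact: measurable_set1.
exact: countable_lebesgue_measure0.
Qed.

(** * Level sets of nowhere monotone functions *)

(** Meagerness asks for a family of sets whose union is exactly [A], indexed by
    the natural numbers: hence the traces [A `&` E j], padded with empty sets at
    the indices that code no element of [J]. *)
Lemma meager_sub_bigcup (T : topologicalType) (J : countType) (E : J -> set T)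
    (A : set T) :
  (forall j, nowhere_dense (E j)) -> A `<=` \bigcup_j E j -> meager A.
Proof.
move=> Enwd AE.
exists (fun n => if unpickle n is Some j then A `&` E j else set0).
  move=> n; case: unpickle => [j|]; last by rewrite /nowhere_dense closure0 interior0.
  apply/seteqP; split => // x; rewrite -(Enwd j).
  by apply: interiorS; apply: closureS; exact: subIsetr.
apply/seteqP; split => [x Ax|x [n _]]; last by case: unpickle => [j []|].
by have [j _ Ej] := AE x Ax; exists (pickle j) => //; rewrite pickleK.
Qed.

Section LevelSets.
Context {R : realType}.
Local Notation I := (set_type (unit_itv R)).
Implicit Types (f g : C01 R) (s t r : I) (a b x y : R).

(** Monotonicity on the part of the unit interval lying between two reals, which
    need not themselves be in it. *)
Definition nondecreasing_between a b : set (C01 R) :=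
  [set f | forall s t, a <= val s -> val s <= val t -> val t <= b -> f s <= f t].

Definition monotone_between a b : set (C01 R) :=
  [set f | nondecreasing_between a b f \/ nondecreasing_between a b (- f)].

Definition nowhere_monotone f :=
  forall a b, 0 <= a -> a < b -> b <= 1 -> ~ monotone_between a b f.

Definition sole_preimage f a b t :=
  a < val t < b /\ forall s, a < val s < b -> f s = f t -> s = t.

Lemma sole_preimageN f a b t :
  sole_preimage f a b t -> sole_preimage (- f) a b t.
Proof. by move=> [abt ft]; split=> // s abs /oppr_inj; exact: ft. Qed.

(** If values with a sole preimage in the interval are dense between [f t1] and
    [f t2], then [f] cannot oscillate between [t1] and [t2]: a value of this kind
    would be taken on the way up and again on the way down. *)
Lemma nondecreasing_between_sole f a b t1 t2 :
  sole_preimage f a b t1 -> sole_preimage f a b t2 ->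
  val t1 < val t2 -> f t1 < f t2 ->
  (forall u v, f t1 <= u -> u < v -> v <= f t2 ->
     exists2 t, sole_preimage f a b t & u < f t < v) ->
  nondecreasing_between (val t1) (val t2) f.
Proof.
move=> [/andP[at1 t1b] u1] [/andP[at2 t2b] u2] t12 f12 dense.
have between s : val t1 <= val s -> val s <= val t2 -> a < val s < b.
  by move=> t1s st2; rewrite (lt_le_trans at1 t1s) (le_lt_trans st2 t2b).
(* [f] stays within [f t1, f t2], otherwise it takes one of these two values a
   second time; so the values at [s] and [t] below lie in the dense range. *)
have range12 s : val t1 <= val s -> val s <= val t2 -> f t1 <= f s <= f t2.
  move=> t1s st2; apply/andP; split; rewrite leNgt; apply/negP => fs.
    have [||r /andP[sr rt2] fr] := @C01_IVT R f s t2 (f t1) => //.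
      by rewrite ge_min le_max (ltW fs) (ltW f12) orbT.
    have rt1 : r = t1 by apply: u1 => //; apply: between => //; exact: le_trans sr.
    have /val_inj st1 : val s = val t1 by apply/eqP; rewrite eq_le t1s -rt1 sr.
    by rewrite st1 ltxx in fs.
  have [||r /andP[t1r rs] fr] := @C01_IVT R f t1 s (f t2) => //.
    by rewrite ge_min le_max (ltW fs) (ltW f12) orbT.
  have rt2 : r = t2 by apply: u2 => //; apply: between => //; exact: le_trans st2.
  have /val_inj s2 : val s = val t2 by apply/eqP; rewrite eq_le st2 -rt2 rs.
  by rewrite s2 ltxx in fs.
move=> s t t1s st tt2; rewrite leNgt; apply/negP => fts.
have t1t := le_trans t1s st; have st2 := le_trans st tt2.
have /andP[f1t _] := range12 _ t1t tt2.
have /andP[_ fs2] := range12 _ t1s st2.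
(* A descent from [s] to [t] crosses the value of [w] before [s] and after [s]. *)
have [w [_ uw] /andP[ftw fws]] := dense _ _ f1t fts fs2.
have [||r /andP[t1r rs] fr] := @C01_IVT R f t1 s (f w) => //.
  by rewrite ge_min le_max (ltW fws) (ltW (le_lt_trans f1t ftw)) orbT.
have [||q /andP[sq qt] fq] := @C01_IVT R f s t (f w) => //.
  by rewrite ge_min le_max (ltW fws) (ltW ftw) orbT.
have rw : r = w by apply: uw => //; apply: between => //; exact: le_trans st2.
have qw : q = w.
  by apply: uw => //; apply: between => //; [exact: le_trans sq|exact: le_trans tt2].
have /val_inj sw : val s = val w.
  by apply/eqP; rewrite eq_le -{1}qw sq -rw rs.
by rewrite sw ltxx in fws.
Qed.

Definition sole_level f a b : set (set_type (range f)) :=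
  [set y | exists2 t, sole_preimage f a b t & f t = val y].
Arguments sole_level : clear implicits.

Lemma in_range_between f t1 t2 y : f t1 <= y <= f t2 -> range f y.
Proof.
move=> /andP[y1 y2]; have [t12|/ltW t21] := leP (val t1) (val t2).
  have [||r _ fr] := @C01_IVT R f t1 t2 y => //; last by exists r.
  by rewrite ge_min le_max y1 y2 orbT.
have [||r _ fr] := @C01_IVT R f t2 t1 y => //; last by exists r.
by rewrite ge_min le_max y1 y2 orbT.
Qed.

(** The range is an interval, not reduced to a point, so a relatively open set
    around [y0] contains an interval of values on one side of [y0]: density in
    the relative topology becomes density in the real interval required by
    [nondecreasing_between_sole]. *)
Lemma nowhere_dense_sole_level f a b :
  nowhere_monotone f -> nowhere_dense (sole_level f a b).
Proof.
move=> fnm; apply/seteqP; split => // y0 /nbhs_ballP[e /= e0 y0e].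
have [c [d [cd cdE]]] : exists c d, c < d /\ forall w, c < w < d ->
    exists2 y : set_type (range f), closure (sole_level f a b) y & val y = w.
  have [t0 _ ft0] := set_valP y0.
  have inE w t : `|val y0 - w| < e ->
      Num.min (f t0) (f t) <= w <= Num.max (f t0) (f t) ->
      exists2 y : set_type (range f), closure (sole_level f a b) y & val y = w.
    move=> yw fw; have rw : range f w.
      move: fw; have [_|_] := leP (f t0) (f t); exact: in_range_between.
    by exists (SigSub (mem_set rw)) => //; apply: y0e; rewrite /ball /=.
  have [t1 ft1] : exists t1, f t1 != f t0.
    apply: contrapT => fc; apply: (fnm 0 1) => //; left => s t _ _ _.
    suff fE r : f r = f t0 by rewrite !fE.
    by apply/eqP; apply: contrapT => /negP fr; apply: fc; exists r.
  have [lt01|lt10|eq01] := ltgtP (f t0) (f t1); last by rewrite eq01 eqxx in ft1.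
    exists (f t0), (Num.min (f t1) (f t0 + e)); split.
      by rewrite lt_min lt01 ltrDl.
    move=> w /andP[w0]; rewrite lt_min => /andP[w1 we]; apply: (inE w t1).
      by rewrite -ft0 ltr_norml; apply/andP; split; lra.
    by rewrite ge_min le_max (ltW w0) (ltW w1) orbT.
  exists (Num.max (f t1) (f t0 - e)), (f t0); split.
    by rewrite gt_max lt10 gtrBl.
  move=> w /andP[]; rewrite gt_max => /andP[w1 we] w0; apply: (inE w t1).
    by rewrite -ft0 ltr_norml; apply/andP; split; lra.
  by rewrite ge_min le_max (ltW w0) (ltW w1) orbT.
have dense u v : c <= u -> u < v -> v <= d ->
    exists2 t, sole_preimage f a b t & u < f t < v.
  move=> cu uv vd; have [|y clE yE] := cdE ((u + v) / 2).
    by apply/andP; split; lra.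
  have [|z [[t tS ft] yz]] := clE (ball y ((v - u) / 2)).
    by apply: nbhsx_ballx; lra.
  have {}yz : `|val y - val z| < (v - u) / 2 := yz.
  exists t => //; move: yz; rewrite yE -ft ltr_norml => /andP[z1 z2].
  by apply/andP; split; lra.
have [|||t1 t1S /andP[ct1 t1m]] := dense c ((c + d) / 2); try lra.
have [|||t2 t2S /andP[t2m t2d]] := dense ((c + d) / 2) d; try lra.
have f12 : f t1 < f t2 by lra.
have /andP[t10 t11] := unit_itvP t1; have /andP[t20 t21] := unit_itvP t2.
(* If [t2] comes first, [f] decreases between them: pass to [- f]. *)
have [lt12|lt21|/val_inj eq12] := ltgtP (val t1) (val t2).
- apply: (fnm _ _ t10 lt12 t21); left; apply: nondecreasing_between_sole => //.
  - exact: t1S.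
  - exact: t2S.
  by move=> u v u1 uv v2; apply: dense; lra.
- apply: (fnm _ _ t20 lt21 t11); right; apply: nondecreasing_between_sole => //.
  - exact: sole_preimageN t2S.
  - exact: sole_preimageN t1S.
  - by rewrite ltrN2.
  move=> u v u1 uv v2.
  have f1v : f t1 <= - v by rewrite lerNr.
  have u2f : - u <= f t2 by rewrite lerNl.
  have [|||t tS /andP[vt tu]] := dense (- v) (- u); try lra.
  exists t; first exact: sole_preimageN.
  have -> : (- f) t = - f t by [].
  by apply/andP; split; lra.
- by rewrite eq12 ltxx in f12.
Qed.

(** The level set is closed, so it fails to be perfect only by having an isolated
    point, which an interval with rational endpoints separates from the rest. *)
Lemma sole_level_of_not_perfect f (y : set_type (range f)) :
  ~ perfect_set (f @^-1` [set val y]) ->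
  exists q1 q2 : rat, sole_level f (ratr q1) (ratr q2) y.
Proof.
move=> yNp; apply: contrapT => ynE; apply: yNp.
have cl : closed (f @^-1` [set val y]).
  apply: (iffLR (continuous_closedP _) (@C01_continuous R f)).
  exact: closed_eq.
have isolated t e : 0 < e -> f t = val y ->
    (forall s, `|val t - val s| < e -> f s = val y -> s = t) ->
    exists q1 q2 : rat, sole_level f (ratr q1) (ratr q2) y.
  move=> e0 ft alone.
  have rational (x z : R) : x < z -> exists q : rat, x < ratr q < z.
    by move=> /rat_in_itvoo[q]; rewrite in_itv; exists q.
  have [|q1 /andP[q1e q1t]] := rational (val t - e) (val t); first lra.
  have [|q2 /andP[tq2 q2e]] := rational (val t) (val t + e); first lra.
  exists q1, q2; exists t => //; split; first by rewrite q1t.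
  move=> s /andP[q1s sq2]; rewrite ft; apply: alone.
  by rewrite ltr_norml; apply/andP; split; lra.
split=> //; apply/seteqP; split.
  apply: subset_trans cl; exact: subset_limit_point.
move=> t ft U /nbhs_ballP[e /= e0 teU]; apply: contrapT => Unone; apply: ynE.
apply: (isolated t e) => // s tse fs; apply: contrapT => st; apply: Unone.
by exists s; split; [exact/eqP|exact: fs|apply: teU; exact: tse].
Qed.

Lemma comeager_perfect_level f : nowhere_monotone f ->
  comeager [set y : set_type (range f) | perfect_set (f @^-1` [set val y])].
Proof.
move=> fnm; pose E (q : rat * rat) := sole_level f (ratr q.1) (ratr q.2).
apply: (@meager_sub_bigcup _ _ E) => [q|y].
  exact: nowhere_dense_sole_level.
by move=> /sole_level_of_not_perfect[q1 [q2 yE]]; exists (q1, q2).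
Qed.

End LevelSets.

(** * A Weierstrass function of infinite variation on every interval *)

Section RoughFunction.
Context {R : realType}.
Local Notation I := (set_type (unit_itv R)).

Lemma cos_lipschitz (x y : R) : `|cos x - cos y| <= `|x - y|.
Proof.
wlog yx : x y / y <= x => [H|].
  by have [/H//|/ltW/H] := leP y x; rewrite distrC [X in _ <= X]distrC.
have [|c _ ->] := @MVT_segment R cos (fun z => - sin z) y x yx.
  exact/continuous_subspaceT/continuous_cos.
rewrite normrM normrN ler_piMl// ler_norml.
by rewrite sin_geN1 sin_le1.
Qed.

Lemma cos_natmul_pi n : cos (n%:R * pi) = (-1) ^+ n :> R.
Proof.
elim: n => [|n IH]; first by rewrite mul0r cos0 expr0.
by rewrite -natr1 mulrDl mul1r cosDpi IH exprS mulN1r.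
Qed.

Lemma wave_continuous (k : nat) :
  continuous (fun t : I => cos (8 ^+ k * pi * val t)).
Proof.
move=> t; apply: continuous_comp; last exact: continuous_cos.
exact: cvgMr (@initial_continuous I R set_val t).
Qed.

Definition wave k : C01 R := C01_of (@wave_continuous k).

(** The frequency grows faster than the amplitude decays, so that the increments
    of order [2^-N] found at scale [8^-N] have an unbounded sum. *)
Definition rough : C01 R := limn (series (fun k => 2^-1 ^+ k *: wave k)).

Lemma cvg_rough : series (fun k => 2^-1 ^+ k *: wave k) @ \oo --> rough.
Proof.
apply: normed_cvg; apply: (@series_le_cvg _ _ (geometric 1 2^-1)).
- by move=> n; exact: normr_ge0.
- by move=> n; rewrite geometric_ge0.
- move=> n /=; rewrite mul1r normrZ ger0_norm// ler_piMr//.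
  by apply: C01_norm_le => t; rewrite ler_norml cos_geN1 cos_le1.
- by apply: is_cvg_geometric_series; rewrite ger0_norm// invf_lt1// ltr1n.
Qed.

Lemma cvg_rough_eval (t : I) :
  (fun n => \sum_(k < n) 2^-1 ^+ k * cos (8 ^+ k * pi * val t)) @ \oo --> rough t.
Proof.
have -> : (fun n => \sum_(k < n) 2^-1 ^+ k * cos (8 ^+ k * pi * val t)) =
    (fun f : C01 R => f t) \o series (fun k => 2^-1 ^+ k *: wave k).
  apply/funext; elim => [|n IH]; first by rewrite big_ord0 /= /series /= big_geq.
  by rewrite big_ord_recr /= IH /series /= big_nat_recr.
apply: (continuous_cvg _ (@C01_eval_continuous R t rough)).
exact: cvg_rough.
Qed.

Definition node (N j : nat) : I := clamp (j%:R / 8 ^+ N).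

Lemma val_node N j : (j <= 8 ^ N)%N -> val (node N j) = j%:R / 8 ^+ N.
Proof.
move=> jN; apply: val_clamp; have N0 : 0 < 8 ^+ N :> R by rewrite exprn_gt0.
apply/andP; split; first by rewrite divr_ge0// ltW.
by rewrite ler_pdivrMr// mul1r -natrX ler_nat.
Qed.

Definition wave_incr (N j k : nat) : R :=
  2^-1 ^+ k * (cos (8 ^+ k * pi * (j.+1%:R / 8 ^+ N)) -
               cos (8 ^+ k * pi * (j%:R / 8 ^+ N))).

Lemma wave_node (N j i : nat) :
  8 ^+ (N + i) * pi * (j%:R / 8 ^+ N) = (8 ^ i * j)%:R * pi :> R.
Proof.
have N0 : 8 ^+ N != 0 :> R by rewrite expf_neq0.
by rewrite exprD natrM natrX; field.
Qed.

(** The next three lemmas compare the contributions of the terms [k] to an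
    increment at scale [8^-N].  Here [k > N]: both arguments of the cosine are
    multiples of [2 pi], [8^(k - N)] being even. *)
Lemma wave_incr_high N j k : (N < k)%N -> wave_incr N j k = 0.
Proof.
move=> Nk; rewrite -(subnKC Nk) addSnnS /wave_incr !wave_node !cos_natmul_pi.
by rewrite -signr_odd -[X in _ - X]signr_odd !oddM !oddX /= subrr mulr0.
Qed.

(** For [k = N] the cosine goes from one of [1, -1] to the other. *)
Lemma wave_incr_diag N j : `|wave_incr N j N| = 2 * 2^-1 ^+ N.
Proof.
rewrite /wave_incr -{2 4}[N]addn0 !wave_node !mul1n !cos_natmul_pi.
have -> : (-1) ^+ j.+1 - (-1) ^+ j = - 2 * (-1) ^+ j :> R by rewrite exprS; ring.
by rewrite !normrM !normrX !normrN1 expr1n mulr1 normrN !ger0_norm// mulrC.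
Qed.

(** The Lipschitz bound, with [pi <= 4].  Summed over [k < N] it yields at most
    [4/3 * 2^-N], less than the contribution [2 * 2^-N] of the term [N]. *)
Lemma wave_incr_low N j k : `|wave_incr N j k| <= 4 * 4 ^+ k / 8 ^+ N.
Proof.
rewrite /wave_incr normrM ger0_norm//.
apply: (@le_trans _ _ (2^-1 ^+ k * (8 ^+ k * pi / 8 ^+ N))).
  apply: ler_wpM2l => //; apply: le_trans (cos_lipschitz _ _) _.
  have -> : 8 ^+ k * pi * (j.+1%:R / 8 ^+ N) - 8 ^+ k * pi * (j%:R / 8 ^+ N) =
      8 ^+ k * pi / 8 ^+ N :> R by rewrite -(natr1 j); ring.
  rewrite ger0_norm//.
  by rewrite !mulr_ge0// ?pi_ge0// invr_ge0.
have -> : 8 ^+ k = 2 ^+ k * 4 ^+ k :> R by rewrite -exprMn -natrM.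
have -> : 2^-1 ^+ k * (2 ^+ k * 4 ^+ k * pi / 8 ^+ N) = pi * 4 ^+ k / 8 ^+ N :> R.
  rewrite !mulrA -exprMn mulVf// expr1n mul1r; congr (_ / _); exact: mulrC.
rewrite ler_wpM2r ?invr_ge0// ler_wpM2r//.
have /andP[] := @pihalf_02 R; lra.
Qed.

Lemma rough_step N j : (j < 8 ^ N)%N ->
  2^-1 ^+ N / 2 <= `|rough (node N j.+1) - rough (node N j)|.
Proof.
move=> jN.
have -> : rough (node N j.+1) - rough (node N j) =
    \sum_(k < N.+1) wave_incr N j k.
  (* The series is a finite sum at the nodes of scale [8^-N]. *)
  have lim : (fun n => \sum_(k < n) wave_incr N j k) @ \oo -->
      rough (node N j.+1) - rough (node N j).
    under eq_fun do (rewrite /wave_incr; under eq_bigr do rewrite mulrBr);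
      under eq_fun do rewrite sumrB.
    rewrite -!val_node ?(ltnW jN)//.
    by apply: cvgB; exact: cvg_rough_eval.
  apply: norm_cvg_unique lim _; apply: cvg_near_cst.
  exists N.+1 => // n /= Nn; apply/eqP.
  rewrite -!(big_mkord xpredT (fun k => wave_incr N j k)) (big_cat_nat _ Nn)//=.
  rewrite [X in _ + X](_ : _ = 0) ?addr0//.
  rewrite big_nat_cond big1// => k /andP[/andP[Nk _] _].
  exact: wave_incr_high.
rewrite big_ord_recr /=.
have low : `|\sum_(k < N) wave_incr N j k| <= 4 / 3 * 2^-1 ^+ N.
  apply: (@le_trans _ _ (\sum_(k < N) 4 * 4 ^+ k / 8 ^+ N)).
    by apply: le_trans (ler_norm_sum _ _ _) (ler_sum _ _) => k _; exact: wave_incr_low.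
  rewrite -mulr_suml -mulr_sumr.
  have -> : \sum_(k < N) 4 ^+ k = (4 ^+ N - 1) / 3 :> R.
    elim: N {jN} => [|n IH]; first by rewrite big_ord0 subrr mul0r.
    by rewrite big_ord_recr /= IH exprS; field.
  have -> : 2^-1 ^+ N = 4 ^+ N / 8 ^+ N :> R.
    by rewrite -expr_div_n; congr (_ ^+ _); field.
  have N0 : 0 <= (8 ^+ N)^-1 :> R by rewrite invr_ge0.
  lra.
have := lerB_normD (wave_incr N j N) (\sum_(k < N) wave_incr N j k).
rewrite wave_incr_diag addrC.
have : 0 <= 2^-1 ^+ N :> R by [].
lra.
Qed.

End RoughFunction.

(** * Monotone perturbations of the rough function *)

Section MonotonePerturbations.
Context {R : realType}.
Local Notation I := (set_type (unit_itv R)).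
Implicit Types (f g : C01 R) (s t : R).

Lemma sum_nondecreasing_increments (h : nat -> R) n :
  (forall i, (i < n)%N -> h i <= h i.+1) ->
  \sum_(i < n) `|h i.+1 - h i| = h n - h 0%N.
Proof.
move=> hh; rewrite -(telescope_sumr h (leq0n n)) big_mkord.
by apply: eq_bigr => i _; rewrite ger0_norm// subr_ge0 hh.
Qed.

Lemma fraction_refine N n p :
  (p * 8 ^ n)%:R / 8 ^+ (N + n) = p%:R / 8 ^+ N :> R.
Proof.
have n0 : 8 ^+ n != 0 :> R by rewrite expf_neq0.
by rewrite natrM natrX exprD invfM mulrACA mulfV// mulr1.
Qed.

Lemma node_refine N n p : node (N + n) (p * 8 ^ n) = node N p :> I.
Proof. by congr clamp; exact: fraction_refine. Qed.

Definition cell_monotone N p : set (C01 R) :=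
  monotone_between (p%:R / 8 ^+ N) (p.+1%:R / 8 ^+ N).

(** On a cell of the grid of step [8^-N] a monotone function has bounded
    variation: along every finer grid the increments add up to the increment
    over the whole cell. *)
Lemma cell_monotone_variation f N p n : (p < 8 ^ N)%N -> cell_monotone N p f ->
  \sum_(i < 8 ^ n) `|f (node (N + n) (p * 8 ^ n + i).+1) -
                     f (node (N + n) (p * 8 ^ n + i))|
    <= `|f (node N p.+1) - f (node N p)|.
Proof.
move=> pN.
have nondecr g : nondecreasing_between (p%:R / 8 ^+ N) (p.+1%:R / 8 ^+ N) g ->
    \sum_(i < 8 ^ n) `|g (node (N + n) (p * 8 ^ n + i).+1) -
                       g (node (N + n) (p * 8 ^ n + i))|
      <= `|g (node N p.+1) - g (node N p)|.
  move=> gmono; pose h i := g (node (N + n) (p * 8 ^ n + i)).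
  have -> : g (node N p.+1) = h (8 ^ n)%N by rewrite /h -mulSnr node_refine.
  have -> : g (node N p) = h 0%N by rewrite /h addn0 node_refine.
  under eq_bigr do rewrite -addnS.
  rewrite (@sum_nondecreasing_increments h) ?ler_norm// => i iN.
  have Sp : (p.+1 * 8 ^ n <= 8 ^ (N + n))%N by rewrite expnD leq_mul2r pN orbT.
  have iS : (p * 8 ^ n + i.+1 <= p.+1 * 8 ^ n)%N by rewrite mulSnr leq_add2l.
  have iS' := leq_trans iS Sp.
  have Nn0 : 0 <= (8 ^+ (N + n))^-1 :> R by rewrite invr_ge0.
  apply: gmono; rewrite -?(fraction_refine N n) !val_node//;
    try by rewrite (leq_trans _ iS')// leq_add2l.
  - by rewrite ler_wpM2r// ler_nat leq_addr.
  - by rewrite ler_wpM2r// ler_nat leq_add2l.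
  - by rewrite ler_wpM2r// ler_nat.
case=> [/nondecr//|/nondecr].
have normN (x y : I) : `|(- f) x - (- f) y| = `|f x - f y|.
  have oppE z : (- f) z = - f z by [].
  by rewrite -normrN !oppE; congr `|_|; ring.
by rewrite normN; under eq_bigr do rewrite normN.
Qed.

(** The variation of [(s - t) *: rough] over a cell would be at most that of the
    two monotone functions, whereas [rough_step] makes it at least of order
    [8^n * 2^-n = 4^n] along the grid refined [n] times. *)
Lemma cell_monotone_line f N p s t : (p < 8 ^ N)%N ->
  cell_monotone N p (s *: rough + f) -> cell_monotone N p (t *: rough + f) ->
  s = t.
Proof.
move=> pN ms mt; apply/eqP; apply: contrapT => /negP st.
have d0 : 0 < `|s - t| by rewrite normr_gt0 subr_eq0.
pose C (h : C01 R) : R := `|h (node N p.+1) - h (node N p)|.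
pose K := C (s *: rough + f) + C (t *: rough + f).
have bound n : n%:R * (`|s - t| * (2^-1 ^+ N / 2)) <= K.
  (* Of the growth [4^n] only the cruder [n < 4^n] is kept: it is all that the
     archimedean property calls for. *)
  apply: (@le_trans _ _ (\sum_(i < 8 ^ n) `|s - t| * (2^-1 ^+ (N + n) / 2))).
    rewrite sumr_const card_ord -[leRHS]mulr_natl exprD.
    have -> : (8 ^ n)%:R * (`|s - t| * (2^-1 ^+ N * 2^-1 ^+ n / 2)) =
        (8 ^ n)%:R * 2^-1 ^+ n * (`|s - t| * (2^-1 ^+ N / 2)) :> R by ring.
    rewrite ler_wpM2r ?mulr_ge0//.
    rewrite natrX -exprMn; have -> : 8 * 2^-1 = 4%:R :> R by field.
    by rewrite -natrX ler_nat ltnW// ltn_expl.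
  have variation := lerD (cell_monotone_variation n pN ms)
                         (cell_monotone_variation n pN mt).
  apply: le_trans variation.
  rewrite -big_split /=; apply: ler_sum => i _.
  have iN : (p * 8 ^ n + i < 8 ^ (N + n))%N.
    apply: (@leq_trans (p.+1 * 8 ^ n)); first by rewrite mulSnr ltn_add2l.
    by rewrite expnD leq_mul2r pN orbT.
  apply: le_trans (ler_wpM2l (ltW d0) (@rough_step R _ _ iN)) _.
  rewrite -normrM; apply: le_trans (ler_normB _ _).
  rewrite le_eqVlt; apply/orP; left.
  set u := node _ _.+1; set v := node _ _.
  have E q x : (q *: rough + f) x = q * rough x + f x by [].
  by apply/eqP; congr `|_|; rewrite !E; ring.
have c0 : 0 < `|s - t| * (2^-1 ^+ N / 2).
  by rewrite mulr_gt0// divr_gt0// exprn_gt0.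
have := bound (Num.truncn (K / (`|s - t| * (2^-1 ^+ N / 2)))).+1.
by rewrite -ler_pdivlMr// leNgt truncnS_gt.
Qed.

(** With [b - a > 2 * 8^-N], the first cell that starts after [a] also ends
    before [b]. *)
Lemma cell_in_interval (a b : R) : 0 <= a -> a < b -> b <= 1 ->
  exists N p, [/\ (p < 8 ^ N)%N, a <= p%:R / 8 ^+ N & p.+1%:R / 8 ^+ N <= b].
Proof.
move=> a0 ab b1.
pose N := (Num.truncn (2 / (b - a))).+1.
have N2 : 2 < (b - a) * 8 ^+ N.
  rewrite mulrC -ltr_pdivrMr ?subr_gt0//; apply: lt_trans (truncnS_gt _) _.
  by rewrite -natrX ltr_nat ltn_expl.
have N0 : 0 < 8 ^+ N :> R by rewrite exprn_gt0.
have aN0 : 0 <= a * 8 ^+ N by rewrite mulr_ge0// ltW.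
have /andP[p1 p2] := truncn_itv aN0.
set p := Num.truncn _ in p1 p2; exists N, p.+1.
have pb : p.+2%:R / 8 ^+ N <= b.
  rewrite ler_pdivrMr//; move: p1 N2; rewrite -!natr1 mulrBl; lra.
split=> //; last by rewrite ler_pdivlMr// ltW.
rewrite -(ler_nat R) natrX.
by apply: le_trans (_ : b * 8 ^+ N <= _); rewrite -?ler_pdivrMr// ler_piMl// ltW.
Qed.

(** Cells replace arbitrary intervals in order to have a countable union, which is
    Borel (even F_sigma) and meets each line of direction [rough] in a countable
    set. *)
Definition somewhere_monotone : set (C01 R) :=
  \bigcup_N \bigcup_(p in [set p | (p < 8 ^ N)%N]) cell_monotone N p.

Lemma nowhere_monotone_cells f : ~ somewhere_monotone f -> nowhere_monotone f.
Proof.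
move=> fN a b a0 ab b1 fab; apply: fN.
have [N [p [pN ap pb]]] := cell_in_interval a0 ab b1.
exists N => //; exists p => //.
by case: fab => fab; [left|right] => s t ps st tp; apply: fab => //;
   [exact: le_trans ps|exact: le_trans pb|exact: le_trans ps|exact: le_trans pb].
Qed.

Lemma closed_nondecreasing_between (a b : R) :
  closed (nondecreasing_between a b : set (C01 R)).
Proof.
have -> : nondecreasing_between a b = \bigcap_(st in
    [set st : I * I | [/\ a <= val st.1, val st.1 <= val st.2 & val st.2 <= b]])
    ((fun f : C01 R => f st.2 - f st.1) @^-1` [set x | 0 <= x]).
  apply/seteqP; split => [f fab [s t] [/= as_ st tb]|f fab s t as_ st tb].
    by rewrite subr_ge0; exact: fab.
  by rewrite -subr_ge0; apply: (fab (s, t)).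
apply: closed_bigI => -[s t] _; apply: closed_comp; last exact: closed_ge.
move=> f _; exact: (cvgB (@C01_eval_continuous R t f) (@C01_eval_continuous R s f)).
Qed.

Lemma closed_monotone_between (a b : R) :
  closed (monotone_between a b : set (C01 R)).
Proof.
apply: closedU; first exact: closed_nondecreasing_between.
apply: (closed_comp (f := -%R)); last exact: closed_nondecreasing_between.
by move=> f _; exact: opp_continuous.
Qed.

Lemma measurable_somewhere_monotone :
  measurable (somewhere_monotone : set (borelType (C01 R))).
Proof.
apply: bigcup_measurable => N _; apply: bigcup_measurable => p _.
rewrite -[X in measurable X]setCK; apply: measurableC.
apply: sub_sigma_algebra; exact/closed_openC/closed_monotone_between.
Qed.

Lemma countable_somewhere_monotone_line f :
  countable [set t : R | somewhere_monotone (t *: rough + f)].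
Proof.
rewrite (_ : [set _ | _] = \bigcup_N \bigcup_(p in [set p | (p < 8 ^ N)%N])
    [set t | cell_monotone N p (t *: rough + f)]); last first.
  by apply/seteqP; split => t [N _ [p pN m]]; exists N => //; exists p.
apply: bigcup_countable => // N _; apply: bigcup_countable => // p pN.
apply/finite_set_countable.
have [->|/set0P[s ms]] := eqVneq [set t | cell_monotone N p (t *: rough + f)] set0.
  exact: finite_set0.
apply: (sub_finite_set _ (finite_set1 s)) => t mt.
exact: cell_monotone_line pN mt ms.
Qed.

End MonotonePerturbations.

Theorem corollary5p2 (R : realType) :
  prevalent [set f : C01 R |
    comeager [set y : set_type (range f) | perfect_set (f @^-1` [set val y])]].
Proof.
apply: (shy_of_countable_line measurable_somewhere_monotone _
  countable_somewhere_monotone_line) => f fNperfect.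
apply: contrapT => fN; apply: fNperfect.
exact/comeager_perfect_level/nowhere_monotone_cells.
Qed.
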